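(* Let $G$ be a countable discrete group, $X$ a countable discrete set, and $\alpha: G \curvearrowright X$ an action. If the restriction of $\alpha$ to each of its orbits is sofic, then $\alpha$ is sofic.
   Context: For a nonempty finite set $A$, $\mathrm{Sym}(A)$ is the group of permutations of $A$, with the normalized Hamming distance $d(\sigma,\tau) = |\{a \in A : \sigma(a) \neq \tau(a)\}|/|A|$. Let $\alpha: G \curvearrowright X$ be an action of a countable discrete group on a countable discrete set, $A$ a finite set, $\varphi: G \to \mathrm{Sym}(A)$ a map (not necessarily a homomorphism). $\varphi$ is unital if $\varphi(1_G) = 1$. For finite $F \subseteq G$ and $\epsilon > 0$, $\varphi$ is $(F,\epsilon)$-multiplicative if $d(\varphi(gh), \varphi(g)\varphi(h)) < \epsilon$ for all $g,h \in F$. For finite $F \subseteq G$, finite $E \subseteq X$ and $\epsilon > 0$, $\varphi$ is an $(F,E,\epsilon)$-orbit approximation of $\alpha$ if there exist a finite set $B$ and a subset $S \subseteq A$ with $|S| > (1-\epsilon)|A|$ and, for each $s \in S$, an injective map $\pi_s: E \hookrightarrow B$, such that $\pi_{\varphi(g)s}(x) = \pi_s(\alpha(g^{-1})x)$ for all $s \in S$, $g \in F$, $x \in E$ whenever $\varphi(g)s \in S$ and $\alpha(g^{-1})x \in E$. The action $\alpha$ is sofic if for all finite $F \subseteq G$, finite $E \subseteq X$ and $\epsilon > 0$ there exist a finite set $A$ and a map $\varphi: G \to \mathrm{Sym}(A)$ which is unital, $(F,\epsilon)$-multiplicative, and an $(F,E,\epsilon)$-orbit approximation of $\alpha$. *)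

(* Defs.v *)
From HB Require Import structures.
From mathcomp Require Import all_boot all_order all_algebra all_fingroup finmap.
From mathcomp Require Import boolp classical_sets cardinality reals.
Set Implicit Arguments.
Unset Strict Implicit.
Unset Printing Implicit Defensive.
Import Order.TTheory GRing.Theory Num.Theory.
Local Open Scope ring_scope.

(* Left actions of a possibly infinite group; mathcomp's [action] only covers
   right actions of finite groups. *)
Record group_action (G : groupType) (X : Type) := GroupAction {
  act :> G -> X -> X;
  act1 : forall x, act 1%g x = x;
  actM : forall g h x, act (g * h)%g x = act g (act h x)
}.

Definition act_invariant (G : groupType) (X : Type)
    (alpha : group_action G X) (Y : set X) : Prop :=
  forall (g : G) (y : X), Y y -> Y (alpha g y).

Definition restr_fun (G : groupType) (X : Type)
    (alpha : group_action G X) (Y : set X) (invY : act_invariant alpha Y)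
    (g : G) (y : Y) : Y :=
  exist (fun x : X => x \in Y) (alpha g (val y))
    (mem_set (invY g _ (set_mem (valP y)))).

Lemma restr_fun1 (G : groupType) (X : Type)
    (alpha : group_action G X) (Y : set X) (invY : act_invariant alpha Y)
    (y : Y) : restr_fun invY 1%g y = y.
Proof. by apply: val_inj; rewrite /= act1. Qed.

Lemma restr_funM (G : groupType) (X : Type)
    (alpha : group_action G X) (Y : set X) (invY : act_invariant alpha Y)
    (g h : G) (y : Y) :
  restr_fun invY (g * h)%g y = restr_fun invY g (restr_fun invY h y).
Proof. by apply: val_inj; rewrite /= actM. Qed.

Definition restr_action (G : groupType) (X : Type)
    (alpha : group_action G X) (Y : set X) (invY : act_invariant alpha Y) :
    group_action G Y :=
  GroupAction (restr_fun1 invY) (restr_funM invY).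

Definition act_orbit (G : groupType) (X : Type)
    (alpha : group_action G X) (x : X) : set X :=
  [set y | exists g : G, alpha g x = y]%classic.

Lemma act_orbit_invariant (G : groupType) (X : Type)
    (alpha : group_action G X) (x : X) :
  act_invariant alpha (act_orbit alpha x).
Proof. by move=> g _ [h <-]; exists (g * h)%g; rewrite actM. Qed.

Definition orbit_action (G : groupType) (X : Type)
    (alpha : group_action G X) (x : X) : group_action G (act_orbit alpha x) :=
  restr_action (act_orbit_invariant (alpha := alpha) (x := x)).

Definition hamming (R : realType) (A : finType) (s t : {perm A}) : R :=
  #|[set a | s a != t a]|%:R / #|A|%:R.

Definition unital (G : groupType) (A : finType) (phi : G -> {perm A}) : Prop :=
  phi 1%g = 1%g.

(* In {perm A}, (s * t) a = t (s a), so the composition "phi(h) first, then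
   phi(g)" is written phi h * phi g. *)
Definition multiplicative_upto (R : realType) (G : groupType) (A : finType)
    (phi : G -> {perm A}) (F : {fset G}) (eps : R) : Prop :=
  forall g h : G, g \in F -> h \in F ->
    hamming R (phi (g * h)%g) (phi h * phi g)%g < eps.

(* The maps pi s with s outside S are irrelevant. [` hx] is alpha(g^-1) x seen
   as an element of E. *)
Definition orbit_approximation (R : realType) (G : groupType) (X : choiceType)
    (alpha : group_action G X) (A : finType) (phi : G -> {perm A})
    (F : {fset G}) (E : {fset X}) (eps : R) : Prop :=
  exists (B : finType) (S : {set A}) (pi : A -> E -> B),
    [/\ (1 - eps) * #|A|%:R < #|S|%:R,
        forall s : A, s \in S -> injective (pi s)
      & forall (s : A) (g : G) (x : E) (hx : alpha g^-1%g (val x) \in E),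
          s \in S -> g \in F -> phi g s \in S ->
          pi (phi g s) x = pi s [` hx]%fset].

Definition sofic_action (R : realType) (G : groupType) (X : choiceType)
    (alpha : group_action G X) : Prop :=
  forall (F : {fset G}) (E : {fset X}) (eps : R), 0 < eps ->
    exists (A : finType) (phi : G -> {perm A}),
      [/\ (0 < #|A|)%N,
          unital phi,
          multiplicative_upto phi F eps
        & orbit_approximation alpha phi F E eps].

(* Main.v *)
Require Import Defs.
From mathcomp Require Import all_boot all_order all_algebra all_fingroup finmap.
From mathcomp Require Import boolp classical_sets cardinality reals.
From mathcomp Require Import lra fintype finset finmap.

(* A finite set E meets only finitely many orbits. Given approximations on
   A1 and A2 for two invariant pieces E1 and E2 of E, the product A1 * A2 with
   the componentwise permutations approximates E: the errors add up, and s maps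
   x in E1 to pi1 (s.1) x and x in E2 to pi2 (s.2) x, in a disjoint union. The
   orbits met by E are treated one at a time, halving epsilon at each step. *)

Set Implicit Arguments.
Unset Strict Implicit.
Unset Printing Implicit Defensive.
Import Order.TTheory GRing.Theory Num.Theory.
Local Open Scope ring_scope.

(** The condition inside [sofic_action] for one fixed triple, isolated so that [E] can be cut into
    pieces and [eps] halved. *)
Definition approximable (R : realType) (G : groupType) (X : choiceType)
    (alpha : group_action G X) (F : {fset G}) (E : {fset X}) (eps : R) : Prop :=
  exists (A : finType) (phi : G -> {perm A}),
    [/\ (0 < #|A|)%N,
        unital phi,
        multiplicative_upto phi F eps
      & orbit_approximation alpha phi F E eps].

Section ProductPerm.
Variables A1 A2 : finType.
Implicit Types (s : {perm A1}) (t : {perm A2}).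

Definition pair_map s t (a : A1 * A2) : A1 * A2 := (s a.1, t a.2).

Lemma pair_map_inj s t : injective (pair_map s t).
Proof. by move=> [a b] [c d] [] /perm_inj -> /perm_inj ->. Qed.

Definition prod_perm s t : {perm A1 * A2} := perm (@pair_map_inj s t).

Lemma prod_permE s t a : prod_perm s t a = (s a.1, t a.2).
Proof. exact: permE. Qed.

Lemma prod_perm1 : prod_perm 1%g 1%g = 1%g.
Proof. by apply/permP => -[a b]; rewrite prod_permE !perm1. Qed.

Lemma prod_permM s s' t t' :
  (prod_perm s t * prod_perm s' t')%g = prod_perm (s * s')%g (t * t')%g.
Proof. by apply/permP => a; rewrite permM !prod_permE !permM. Qed.

End ProductPerm.

(** Union bound: [D] is covered by the cylinders over [D1] and [D2], each of density below
    [eps / 2]. It serves both for the Hamming distance and for the complement of the good set. *)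
Lemma card_prod_lt (R : realType) (A1 A2 : finType) (D1 : {set A1})
    (D2 : {set A2}) (D : {set A1 * A2}) (eps : R) :
    (0 < #|A1|)%N -> (0 < #|A2|)%N ->
    D \subset [set a | (a.1 \in D1) || (a.2 \in D2)] ->
    #|D1|%:R < eps / 2 * #|A1|%:R -> #|D2|%:R < eps / 2 * #|A2|%:R ->
  #|D|%:R < eps * #|{: A1 * A2}|%:R.
Proof.
move=> A1gt0 A2gt0 subD D1lt D2lt.
have leD : (#|D| <= #|D1| * #|A2| + #|A1| * #|D2|)%N.
  apply: leq_trans (subset_leq_card subD) _.
  have -> : [set a | (a.1 \in D1) || (a.2 \in D2)] =
            setX D1 [set: A2] :|: setX [set: A1] D2.
    by apply/setP => -[a b]; rewrite !inE /= andbT.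
  rewrite -[#|A1|]cardsT -[#|A2|]cardsT -!cardsX.
  exact: leq_card_setU.
apply: (@le_lt_trans _ _ (#|D1| * #|A2| + #|A1| * #|D2|)%:R).
  by rewrite ler_nat.
rewrite card_prod natrD !natrM.
have h1 : #|D1|%:R * #|A2|%:R < eps / 2 * #|A1|%:R * #|A2|%:R :> R.
  by rewrite ltr_pM2r // ltr0n.
have h2 : #|A1|%:R * #|D2|%:R < #|A1|%:R * (eps / 2 * #|A2|%:R) :> R.
  by rewrite ltr_pM2l // ltr0n.
lra.
Qed.

Lemma hamming_lt (R : realType) (A : finType) (s t : {perm A}) (eps : R) :
  (0 < #|A|)%N ->
  (hamming R s t < eps) = (#|[set a | s a != t a]|%:R < eps * #|A|%:R).
Proof. by move=> A0; rewrite /hamming ltr_pdivrMr // ltr0n. Qed.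

Lemma card_gt_setC (R : realType) (A : finType) (S : {set A}) (eps : R) :
  ((1 - eps) * #|A|%:R < #|S|%:R) = (#|~: S|%:R < eps * #|A|%:R).
Proof.
have -> : #|S|%:R = #|A|%:R - #|~: S|%:R :> R.
  by rewrite -(cardsC S) natrD addrK.
by apply/idP/idP => ?; lra.
Qed.

Lemma multiplicative_prod (R : realType) (G : groupType) (A1 A2 : finType)
    (phi1 : G -> {perm A1}) (phi2 : G -> {perm A2}) (F : {fset G}) (eps : R) :
    (0 < #|A1|)%N -> (0 < #|A2|)%N ->
    multiplicative_upto phi1 F (eps / 2) ->
    multiplicative_upto phi2 F (eps / 2) ->
  multiplicative_upto (fun g => prod_perm (phi1 g) (phi2 g)) F eps.
Proof.
move=> A1gt0 A2gt0 mul1 mul2 g h gF hF.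
move: (mul1 g h gF hF) (mul2 g h gF hF).
rewrite !hamming_lt ?card_prod ?muln_gt0 ?A1gt0 // -card_prod => d1 d2.
apply: card_prod_lt d1 d2 => //.
(* Product permutations that disagree at a pair disagree in one of its coordinates. *)
apply/subsetP => -[a b]; rewrite !inE prod_permM !prod_permE /=.
by rewrite -negb_and; apply: contra => /andP[/eqP -> /eqP ->].
Qed.

Section InvariantPieces.
Variables (R : realType) (G : groupType) (X : choiceType).
Variables (alpha : group_action G X) (P : pred X).
Hypothesis P_inv : forall g x, P (alpha g x) = P x.

(** The disjoint union is realised inside [option B1 * option B2]: exactly one component is a
    [Some], and which one is decided by [P x]. Since [P] is invariant, [x] and its translate lie on
    the same side, so equivariance is checked in each component. *)
Lemma orbit_approximation_prod (A1 A2 : finType)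
    (phi1 : G -> {perm A1}) (phi2 : G -> {perm A2})
    (F : {fset G}) (E : {fset X}) (eps : R) :
    (0 < #|A1|)%N -> (0 < #|A2|)%N ->
    orbit_approximation alpha phi1 F [fset x in E | P x]%fset (eps / 2) ->
    orbit_approximation alpha phi2 F [fset x in E | ~~ P x]%fset (eps / 2) ->
  orbit_approximation alpha (fun g => prod_perm (phi1 g) (phi2 g)) F E eps.
Proof.
move=> A1gt0 A2gt0 [B1 [S1 [pi1 [S1lt inj1 eqv1]]]].
move=> [B2 [S2 [pi2 [S2lt inj2 eqv2]]]].
set E1 := [fset x in E | P x]%fset in pi1 inj1 eqv1 *.
set E2 := [fset x in E | ~~ P x]%fset in pi2 inj2 eqv2 *.
have inE1 x : (x \in E1) = (x \in E) && P x by rewrite !inE.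
have inE2 x : (x \in E2) = (x \in E) && ~~ P x by rewrite !inE.
(* An x outside a piece is sent to None in the corresponding component. *)
pose pi (s : A1 * A2) (x : E) : option B1 * option B2 :=
  (omap (pi1 s.1) (insub (val x)), omap (pi2 s.2) (insub (val x))).
exists (option B1 * option B2)%type, (setX S1 S2), pi; split.
- move: S1lt S2lt; rewrite !card_gt_setC => S1lt S2lt.
  apply: card_prod_lt S1lt S2lt => //.
  by apply/subsetP => -[a b]; rewrite !inE /= negb_and.
- move=> [s1 s2]; rewrite in_setX /= => /andP[s1S s2S] x y [].
  have xE := valP x; have yE := valP y.
  (* The component that is a [Some] at [x] must also be one at [y]; this puts both points in the
     same piece, where [inj1] or [inj2] applies. *)
  case: insubP => [u|]; rewrite inE1 xE /= => Px; last move=> _.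
    move=> ux; case: insubP => [v _ vy /=|//] [/(inj1 _ s1S) uv] _.
    by apply: val_inj; rewrite /= -ux -vy uv.
  case: insubP => [u _ ux|]; last by rewrite inE2 xE Px.
  case: insubP => [v _ vy /=|//] [/(inj2 _ s2S) uv].
  by apply: val_inj; rewrite /= -ux -vy uv.
- move=> [s1 s2] g x hx; rewrite prod_permE !in_setX /=.
  move=> /andP[s1S s2S] gF /andP[gs1S gs2S]; have xE := valP x.
  rewrite /pi /=; congr pair.
  (* Outside [E1] both sides are [None], by invariance of [P]. *)
  + case: insubP => [u|]; rewrite inE1 xE /= => Px; last first.
      by rewrite insubN // inE1 P_inv (negbTE Px) andbF.
    move=> ux.
    have hu : alpha g^-1%g (val u) \in E1 by rewrite inE1 P_inv /= ux hx.
    rewrite /= (eqv1 _ _ _ hu) //; case: insubP => [v _ vx|].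
      by rewrite /=; congr (Some (pi1 _ _)); apply: val_inj; rewrite vx /= ux.
    by rewrite -ux hu.
  + case: insubP => [u|]; rewrite inE2 xE /= => Px; last first.
      by rewrite insubN // inE2 P_inv (negbTE Px) andbF.
    move=> ux.
    have hu : alpha g^-1%g (val u) \in E2 by rewrite inE2 P_inv /= ux hx.
    rewrite /= (eqv2 _ _ _ hu) //; case: insubP => [v _ vx|].
      by rewrite /=; congr (Some (pi2 _ _)); apply: val_inj; rewrite vx /= ux.
    by rewrite -ux hu.
Qed.

Lemma approximable_split (F : {fset G}) (E : {fset X}) (eps : R) :
    approximable alpha F [fset x in E | P x]%fset (eps / 2) ->
    approximable alpha F [fset x in E | ~~ P x]%fset (eps / 2) ->
  approximable alpha F E eps.
Proof.
move=> [A1 [phi1 [A1gt0 u1 m1 o1]]] [A2 [phi2 [A2gt0 u2 m2 o2]]].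
exists (A1 * A2)%type, (fun g => prod_perm (phi1 g) (phi2 g)); split.
- by rewrite card_prod muln_gt0 A1gt0.
- by rewrite /unital u1 u2 prod_perm1.
- exact: multiplicative_prod.
- exact: orbit_approximation_prod.
Qed.

End InvariantPieces.

Section RestrictionToInvariant.
Variables (R : realType) (G : groupType) (X : choiceType).
Variables (alpha : group_action G X) (Y : set X).
Variable invY : act_invariant alpha Y.

(** Since [E] lies in [Y], it lifts to a finite set [E'] of points of [Y]; the maps obtained for
    [E'] are pulled back along this lift, which is injective and commutes with the actions. *)
Lemma approximable_restr (F : {fset G}) (E : {fset X}) (eps : R) :
    0 < eps -> (forall x, x \in E -> Y x) ->
    sofic_action R (restr_action invY) ->
  approximable alpha F E eps.
Proof.
move=> eps0 EY sofY.
pose f (e : E) : Y := exist _ (val e) (mem_set (EY _ (valP e))).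
pose E' : {fset Y} := [fset f e | e in {: E}]%fset.
have fE' e : f e \in E' by apply: in_imfset.
have [A [phi [A0 uphi mphi [B [S [pi [Slt inj eqv]]]]]]] := sofY F E' eps eps0.
exists A, phi; split=> //.
exists B, S, (fun s e => pi s [` fE' e]%fset); split=> //.
  by move=> s sS x y /(inj _ sS) /(congr1 (fun u => val (val u))) /= /val_inj.
move=> s g x hx sS gF gsS.
have fg : restr_action invY g^-1%g (f x) = f [` hx]%fset by exact: val_inj.
have hfx : restr_action invY g^-1%g (val [` fE' x]%fset) \in E'.
  by rewrite [X in X \in _]fg.
by rewrite (eqv _ _ _ hfx) //; congr (pi s _); apply: val_inj.
Qed.

End RestrictionToInvariant.

(** On a one-point set the constant identity map is exactly multiplicative, and injectivity on
    [fset0] is vacuous. *)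
Lemma approximable0 (R : realType) (G : groupType) (X : choiceType)
    (alpha : group_action G X) (F : {fset G}) (eps : R) :
  0 < eps -> approximable alpha F fset0 eps.
Proof.
move=> eps0; exists unit, (fun=> 1%g); split=> //; first by rewrite card_unit.
  move=> g h _ _; rewrite hamming_lt ?card_unit // mulr1.
  by rewrite mulg1 eq_card0 // => a; rewrite !inE eqxx.
exists unit, [set: unit], (fun _ _ => tt); split.
- by rewrite card_gt_setC setCT cards0 card_unit mulr1.
- by move=> s _ [].
- by [].
Qed.

Lemma act_orbit_act (G : groupType) (X : Type) (alpha : group_action G X)
    (x : X) (g : G) (y : X) :
  act_orbit alpha x (alpha g y) <-> act_orbit alpha x y.
Proof.
split=> [gy|]; last exact: act_orbit_invariant.
by have := act_orbit_invariant g^-1%g gy; rewrite -Defs.actM mulVg Defs.act1.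
Qed.

Theorem proposition2p16 (R : realType) (G : groupType) (X : choiceType)
    (alpha : group_action G X)
    (countG : countable [set: G]%classic) (countX : countable [set: X]%classic)
    (orbits_sofic : forall x : X, sofic_action R (orbit_action alpha x)) :
  sofic_action R alpha.
Proof.
move=> F E; have [n] := ubnP #|` E|.
(* Here [eps] stays universally quantified, since the induction hypothesis is applied at
   [eps / 2]. *)
elim: n E => // n IHn E ltEn eps eps0.
have [->|[x xE]] := fset_0Vmem E; first exact: approximable0.
pose P y := `[< act_orbit alpha x y >].
have eps20 : 0 < eps / 2 by rewrite divr_gt0.
apply: (@approximable_split _ _ _ _ P) => [g y||].
- by apply: asbool_equiv_eq; apply: act_orbit_act.
- apply: approximable_restr (orbits_sofic x) => // y.
  by rewrite !inE => /andP[_ /asboolP].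
(* The part of [E] off the orbit of [x] is strictly smaller, as it omits [x] itself. *)
- apply: IHn => //; rewrite -ltnS; apply: leq_trans ltEn; rewrite ltnS.
  apply: fproper_ltn_card; rewrite fproperE; apply/andP; split.
    by apply/fsubsetP => y; rewrite !inE => /andP[].
  apply/negP => /fsubsetP/(_ x xE); rewrite !inE xE /= => /asboolP; apply.
  by exists 1%g; rewrite Defs.act1.
Qed.
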